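(* Let $M\ge 1$, let $s^{(1)},\dots,s^{(M)}$ be positive integers and $\tau^{(1)},\dots,\tau^{(M)}>0$. For each $j=1,2,\dots,\max_k s^{(k)}$ define $$\ell_j:=\#\{1\le k\le M:\ j\le s^{(k)}\}.$$ Then there exist positive constants $C_{12},C_{13},c,C$, depending only on $(s^{(k)},\tau^{(k)})_{k=1}^M$, such that the following holds. Let $\mathcal{X}$ form an $((h^{(k)},\tau^{(k)},s^{(k)})_{k=1}^M,\theta)$-clustered configuration with $h^{(1)}=h^{(2)}=\dots=h^{(M)}=h$. Then for all integers $N$ with $N\theta\ge C_{12}$ and $Nh\le C_{13}$, and for each $j=1,\dots,\max_k s^{(k)}$, there are precisely $\ell_j$ singular values $\sigma$ of $\mathbf{V}_N(\mathcal{X})$ (counted with multiplicity) scaling like $N^{1/2}(Nh)^{j-1}$, i.e. satisfying $$c\,N^{1/2}(Nh)^{j-1}\ \le\ \sigma\ \le\ C\,N^{1/2}(Nh)^{j-1}.$$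
   Context: Wrap-around distance: for $x,y\in\mathbb{R}$, $\Delta(x,y)=|\operatorname{Arg}(e^{\imath(x-y)})|\in[0,\pi]$, where $\operatorname{Arg}$ is the principal argument with values in $(-\pi,\pi]$. Cluster: for $h,\tau>0$, a set of $s$ distinct nodes in $(-\pi,\pi]$ forms an $(h,\tau,s)$-cluster if $\tau h\le\Delta(x,y)\le h$ for all distinct $x,y$ in the set. Clustered configuration: $\mathcal{X}=\{x_1,\dots,x_s\}\subset(-\pi,\pi]$ (with $s=\sum_k s^{(k)}$) forms an $((h^{(k)},\tau^{(k)},s^{(k)})_{k=1}^M,\theta)$-clustered configuration if there is a partition $\mathcal{X}=\biguplus_{k=1}^M\mathcal{C}^{(k)}$ such that for each $k$: $\mathcal{C}^{(k)}$ is an $(h^{(k)},\tau^{(k)},s^{(k)})$-cluster, and $\Delta(x,y)\ge\theta>0$ for all $x\in\mathcal{C}^{(k)}$, $y\in\mathcal{X}\setminus\mathcal{C}^{(k)}$. $\mathbf{V}_N(\mathcal{X})$ is the $(N+1)\times s$ Vandermonde matrix with entries $e^{\imath k x_j}$ ($k=0,\dots,N$, $j=1,\dots,s$). Throughout, $N\ge s-1$. *)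

(* Defs.v *)
From HB Require Import structures.
From mathcomp Require Import all_boot all_order all_algebra.
From mathcomp Require Import finmap complex.
From mathcomp Require Import all_classical all_reals all_analysis.

Set Implicit Arguments.
Unset Strict Implicit.
Unset Printing Implicit Defensive.

Import Order.TTheory GRing.Theory Num.Theory.
Local Open Scope ring_scope.
Local Open Scope sesquilinear_scope.

Section WrapAround.
Variable R : realType.

Definition expi (x : R) : R[i] := (cos x +i* sin x)%C.

(* The defining property determines [Arg z] for [z != 0]; the value at [0] is
   irrelevant. *)
Definition Arg (z : R[i]) : R :=
  xget 0 [set a : R | - pi < a <= pi /\ z = `|z| * expi a]%classic.

Definition wrap_dist (x y : R) : R := `|Arg (expi (x - y))|.

End WrapAround.

Section Clusters.
Variable R : realType.

Definition is_cluster (h tau : R) (s : nat) (C : {fset R}) : Prop :=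
  [/\ 0 < h, 0 < tau, #|` C| = s,
      forall x, x \in C -> - pi < x <= pi
    & forall x y, x \in C -> y \in C -> x != y ->
        tau * h <= wrap_dist x y <= h].

Definition clustered_configuration (M : nat) (h tau : 'I_M -> R)
    (s : 'I_M -> nat) (theta : R) (X : {fset R}) : Prop :=
  0 < theta /\
  exists C : 'I_M -> {fset R},
    [/\ X = (\bigcup_(k in 'I_M) C k)%fset,
        forall k l, k != l -> [disjoint C k & C l]%fset,
        forall k, is_cluster (h k) (tau k) (s k) (C k)
      & forall k x y, x \in C k -> y \in (X `\` C k)%fset ->
          theta <= wrap_dist x y].

Definition vandermonde (N s : nat) (x : 'I_s -> R) : 'M[R[i]]_(N.+1, s) :=
  \matrix_(k < N.+1, j < s) expi (k%:R * x j).

End Clusters.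

Section SingularValues.
Variable R : realType.

(* With algebraic multiplicity. *)
Definition eigenvalues (n : nat) (A : 'M[R[i]]_n) : seq R[i] :=
  sval (closed_field_poly_normal (char_poly A)).

(* The Gram matrix is Hermitian positive semidefinite, so taking real parts
   loses nothing. Truncation to the [minn m n] largest values discards only the
   zeros forced by [\rank A <= m] when [m < n]. *)
Definition singular_values (m n : nat) (A : 'M[R[i]]_(m, n)) : seq R :=
  take (minn m n)
    (sort >=%R [seq Num.sqrt (complex.Re l) | l <- eigenvalues (A ^t* *m A)]).

End SingularValues.

Definition ell (M : nat) (s : 'I_M -> nat) (j : nat) : nat :=
  #|[pred k : 'I_M | (j <= s k)%N]|.

(* Main.v *)
(* Write z_i = exp(i x_i), let r_i be the rank of node i in its cluster, and put
   X = N h and e_p = N^(1/2) X^p.  Two families of subspaces, cut out by linear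
   functionals indexed by the nodes, control the spectrum of V^* V.
   - If u is annihilated by the first p moments of each cluster (#{r_i < p}
     equations), expanding z^n around a centre of the cluster gives
     |V u| <= C e_p |u|.
   - Let P_i be a polynomial of degree at most N with P_i(z_i) = 1 that vanishes
     on the other clusters and on the nodes of lower rank of its own cluster.
     It can be chosen with coefficients O(N^-1 X^(-r_i)): multiply an averaged
     geometric sum by factors (z^q - z_l^q) / (z_i^q - z_l^q), where q = O(N) is
     picked separately for each l so that the denominator is bounded below by a
     constant (other clusters) or by a multiple of X (same cluster).
     If sum_n [z^n]P_i (V u)_n = 0 whenever r_i > p, then solving a
     unitriangular system for u gives |V u| >= c e_p |u|.
   Hence at most #{r_i < p} singular values exceed C e_p and at most
   #{r_i > p} are below c e_p, so at least #{r_i = p} lie in the p-th band.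
   For X < c / C the bands are disjoint, and summing over p forces equality. *)
Require Import Defs.
From mathcomp Require Import all_boot all_order all_algebra.
From mathcomp Require Import finmap complex.
From mathcomp Require Import all_classical all_reals all_analysis.
From mathcomp Require Import lra ring zify.

Set Implicit Arguments.
Unset Strict Implicit.
Unset Printing Implicit Defensive.

Import Order.TTheory GRing.Theory Num.Theory.
Import numFieldNormedType.Exports.
Local Open Scope ring_scope.
Local Open Scope sesquilinear_scope.

Local Notation normc := ComplexField.Normc.normc.

(** * Spectra of Gram matrices and codimension bounds *)

Lemma common_kernel_vector (F : fieldType) (n : nat) (T : finType)
    (f : T -> 'rV[F]_n) :
  (#|T| < n)%N -> exists2 u : 'cV[F]_n, u != 0 & forall t, f t *m u = 0.
Proof.
move=> ltTn; pose B := \matrix_(i < #|T|) f (enum_val i).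
have : kermx B^T != 0.
  rewrite -mxrank_eq0 mxrank_ker -lt0n subn_gt0.
  exact: leq_ltn_trans (rank_leq_col _) ltTn.
case/rowV0Pn=> v /sub_kermxP vB vn0; exists v^T; first by rewrite trmx_eq0.
move=> t; have : B *m v^T = 0 by rewrite -[B]trmxK -trmx_mul vB trmx0.
move=> /(congr1 (row (enum_rank t))); rewrite row_mul row0 => <-.
by rewrite rowK enum_rankK.
Qed.

Section Norms.
Variable R : rcfType.
Implicit Types z w : R[i].

Lemma normc_norm z : (normc z)%:C%C = `|z|. Proof. by []. Qed.

Lemma normc_ge0 z : 0 <= normc z.
Proof. by rewrite -ler0c normc_norm. Qed.

Lemma normcB z w : normc (z - w) = normc (w - z).
Proof. by rewrite -normcN opprB. Qed.

Lemma normcX z n : normc (z ^+ n) = normc z ^+ n.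
Proof.
elim: n => [|n IHn]; first by rewrite !expr0 ComplexField.Normc.normc1.
by rewrite !exprS ComplexField.Normc.normcM IHn.
Qed.

Lemma normc_sum (I : Type) (s : seq I) (P : pred I) (f : I -> R[i]) :
  normc (\sum_(i <- s | P i) f i) <= \sum_(i <- s | P i) normc (f i).
Proof.
elim/big_ind2: _ => //; first by rewrite ComplexField.Normc.normc0.
by move=> x1 x2 y1 y2 h1 h2; apply: le_trans (le_normcD _ _) (lerD h1 h2).
Qed.

Definition normsq n (u : 'cV[R[i]]_n) : R := \sum_i normc (u i 0) ^+ 2.

Lemma normsq_ge0 n (u : 'cV[R[i]]_n) : 0 <= normsq u.
Proof. by apply: sumr_ge0 => i _; rewrite sqr_ge0. Qed.

Lemma normsqE n (u : 'cV[R[i]]_n) : (u^t* *m u) 0 0 = (normsq u)%:C%C.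
Proof.
rewrite /normsq mxE rmorph_sum; apply: eq_bigr => i _ /=.
by rewrite !mxE mulrC -normCK -normc_norm -rmorphXn.
Qed.

End Norms.

Section Gram.
Variables (R : rcfType) (m n : nat) (A : 'M[R[i]]_(m, n)).
Let G := A^t* *m A.
Let P := spectralmx G.
Let d := spectral_diag G.

Lemma gram_spectral : G = P^t* *m diag_mx d *m P.
Proof.
have /orthomx_spectralP : G \is normalmx.
  apply/normalmxP; suff -> : G^t* = G by [].
  by rewrite /G trmx_mul map_mxM trmxCK.
by rewrite invmx_unitary ?spectral_unitarymx.
Qed.

(** The Gram matrix is Hermitian, so its eigenvalues are real and [complex.Re] merely changes their
    type. *)
Definition gram_eigenvalue (i : 'I_n) : R := complex.Re (d 0 i).

Lemma normsq_spectral (u : 'cV[R[i]]_n) : normsq (P *m u) = normsq u.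
Proof.
apply: complexI; rewrite -!normsqE trmx_mul map_mxM -mulmxA.
have PP : P^t* *m P = 1%:M.
  by rewrite -invmx_unitary ?spectral_unitarymx // mulVmx ?spectral_unit.
by rewrite (mulmxA (P^t*)) PP mul1mx.
Qed.

(** The quadratic form of [G] becomes diagonal after the unitary change of coordinates [P].
    Comparing real parts avoids a separate proof that the eigenvalues are real. *)
Lemma normsq_mul_spectral (u : 'cV[R[i]]_n) :
  normsq (A *m u) = \sum_i gram_eigenvalue i * normc ((P *m u) i 0) ^+ 2.
Proof.
have -> : normsq (A *m u) = complex.Re (normsq (A *m u))%:C%C by [].
rewrite -normsqE trmx_mul map_mxM mulmxA -[_ *m _ *m A]mulmxA -/G.
rewrite gram_spectral !mulmxA -[_ *m P *m u]mulmxA.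
rewrite -map_mxM -trmx_mul; set w := P *m u.
rewrite mxE (raddf_sum (@complex.Re R : {additive Rcomplex R -> R})) /=.
apply: eq_bigr => i _; rewrite mul_mx_diag !mxE; set t := \sum_j _.
rewrite mulrAC [t^* * t]mulrC -normCK -normc_norm -rmorphXn mulrC.
by rewrite /gram_eigenvalue; case: (d 0 i) => a b /=; rewrite mulr0 subr0.
Qed.

(** Dimension count: the equations indexed by [Q] and the vanishing of the spectral coordinates
    outside [D] are together fewer than [n]. *)
Lemma spectral_vector (D Q : pred 'I_n) (f : 'I_n -> 'rV[R[i]]_n) :
  (#|Q| < #|D|)%N ->
  exists2 u : 'cV[R[i]]_n, u != 0 &
    (forall i, Q i -> f i *m u = 0) /\ (forall i, ~~ D i -> (P *m u) i 0 = 0).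
Proof.
move=> ltQD; pose T := ({i | Q i} + {i | predC D i})%type.
pose g (t : T) :=
  match t with inl i => f (val i) | inr i => row (val i) P end.
have [|u un0 gu] := @common_kernel_vector _ _ T g.
  rewrite card_sum !card_sig -[n in (_ < n)%N]card_ord -(cardC D).
  by rewrite -addSn leq_add2r.
exists u => //; split=> i hi; first exact: (gu (inl (exist _ i hi))).
have := gu (inr (exist _ i hi)); rewrite /= -row_mul.
by move=> /(congr1 (fun M : 'cV[R[i]]_1 => M 0 0)); rewrite !mxE.
Qed.

Lemma weighted_normsq_gt0 (c : 'I_n -> R) (w : 'cV[R[i]]_n) :
  w != 0 -> (forall i, w i 0 != 0 -> 0 < c i) ->
  0 < \sum_i c i * normc (w i 0) ^+ 2.
Proof.
move=> wn0 cpos.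
have [i wi] : exists i, w i 0 != 0.
  apply/existsP; apply: contraNT wn0 => /existsPn w0.
  by apply/eqP/colP => i; rewrite mxE; have /negPn/eqP := w0 i.
rewrite (bigD1 i) //= ltr_wpDr //.
  apply: sumr_ge0 => j _; have [->|wj] := eqVneq (w j 0) 0.
    by rewrite ComplexField.Normc.normc0 expr0n mulr0.
  by rewrite mulr_ge0 ?sqr_ge0 // ltW ?cpos.
rewrite mulr_gt0 ?cpos // exprn_gt0 // lt_def normc_ge0 andbT.
by apply: contra wi => /eqP/ComplexField.Normc.eq0_normc/eqP.
Qed.

Lemma spectral_neq0 (u : 'cV[R[i]]_n) : u != 0 -> P *m u != 0.
Proof.
by apply: contra => /eqP Pu; rewrite -[u](mulKmx (spectral_unit G)) Pu mulmx0.
Qed.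

(* The eigenvectors with eigenvalue above [mu] span a space that meets the
   common kernel of fewer functionals nontrivially. *)
Lemma card_gram_eigenvalue_gt (mu : R) (Q : pred 'I_n) (f : 'I_n -> 'rV[R[i]]_n) :
  (forall u : 'cV[R[i]]_n, (forall i, Q i -> f i *m u = 0) ->
     normsq (A *m u) <= mu * normsq u) ->
  (#|[pred i | (mu < gram_eigenvalue i)%R]| <= #|Q|)%N.
Proof.
move=> Qle; rewrite leqNgt; apply/negP => /(spectral_vector f)[u un0 [fu Pu]].
have := Qle u fu; apply/negP; rewrite -ltNge normsq_mul_spectral.
rewrite -normsq_spectral /normsq mulr_sumr -subr_gt0 -sumrB.
under eq_bigr do rewrite -mulrBl.
apply: weighted_normsq_gt0 => [|i]; first exact: spectral_neq0.
by rewrite subr_gt0; apply: contraNT => Di; rewrite Pu.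
Qed.

(** Dual count: a nonzero [u] in the common kernel, supported on eigenvectors with eigenvalue below
    [mu], would have [normsq (A *m u) < mu * normsq u]. *)
Lemma card_gram_eigenvalue_lt (mu : R) (Q : pred 'I_n) (f : 'I_n -> 'rV[R[i]]_n) :
  (forall u : 'cV[R[i]]_n, (forall i, Q i -> f i *m u = 0) ->
     mu * normsq u <= normsq (A *m u)) ->
  (#|[pred i | (gram_eigenvalue i < mu)%R]| <= #|Q|)%N.
Proof.
move=> Qle; rewrite leqNgt; apply/negP => /(spectral_vector f)[u un0 [fu Pu]].
have := Qle u fu; apply/negP; rewrite -ltNge normsq_mul_spectral.
rewrite -normsq_spectral /normsq mulr_sumr -subr_gt0 -sumrB.
under eq_bigr do rewrite -mulrBl.
apply: weighted_normsq_gt0 => [|i]; first exact: spectral_neq0.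
by rewrite subr_gt0; apply: contraNT => Di; rewrite Pu.
Qed.

Lemma char_poly_gram :
  char_poly G = \prod_i ('X - (d 0 i)%:P).
Proof.
have PP : P^t* *m P = 1%:M.
  by rewrite -invmx_unitary ?spectral_unitarymx // mulVmx ?spectral_unit.
pose C M : 'M[{poly R[i]}]_n := map_mx polyC M.
have CP : C (P^t*) *m C P = 1%:M by rewrite -map_mxM PP map_mx1.
have -> : char_poly G = char_poly (diag_mx d).
  rewrite /char_poly /char_poly_mx gram_spectral !map_mxM -/(C _) -/(C P).
  (* A scalar matrix is fixed by conjugation, so both copies of [P] factor out of the
     determinant. *)
  rewrite [in LHS](_ : 'X%:M = C (P^t*) *m 'X%:M *m C P); last first.
    by rewrite scalar_mxC -mulmxA CP mulmx1.
  by rewrite -mulmxBl -mulmxBr !det_mulmx mulrAC -det_mulmx CP det1 mul1r.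
rewrite char_poly_trig ?diag_mx_is_trig //.
by apply: eq_bigr => i _; rewrite mxE eqxx mulr1n.
Qed.

End Gram.

Lemma eigenvalues_gram (R : realType) (m n : nat) (A : 'M[R[i]]_(m, n)) :
  perm_eq (eigenvalues (A^t* *m A))
    [seq spectral_diag (A^t* *m A) 0 i | i <- enum 'I_n].
Proof.
rewrite /eigenvalues; case: closed_field_poly_normal => /= r.
rewrite (monicP (char_poly_monic _)) scale1r => Er; apply: prod_XsubC_eq.
by rewrite -Er char_poly_gram big_map big_enum.
Qed.

Lemma count_singular_values (R : realType) (m n : nat) (A : 'M[R[i]]_(m, n))
    (p : pred R) :
  (n <= m)%N ->
  count p (singular_values A) =
    #|[pred i | p (Num.sqrt (gram_eigenvalue A i))]|.
Proof.
move=> lenm; have := perm_size (eigenvalues_gram A).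
rewrite size_map size_enum_ord => szE.
(* Since [n <= m], the truncation keeps all [n] values. *)
rewrite /singular_values take_oversize; last first.
  by rewrite size_sort size_map szE (minn_idPr lenm).
rewrite (permP (permEl (perm_sort _ _))) count_map.
rewrite (permP (eigenvalues_gram A)) count_map.
by rewrite cardE size_filter enumT; apply: eq_count.
Qed.

(** * Interpolating polynomials *)

Section Interpolation.
Variable R : rcfType.
Implicit Types z w : R[i].

Lemma normc_subX_le z w q :
  normc z = 1 -> normc w = 1 -> normc (z ^+ q - w ^+ q) <= q%:R * normc (z - w).
Proof.
move=> z1 w1; rewrite subrXX ComplexField.Normc.normcM mulrC.
rewrite ler_wpM2r ?normc_ge0 //; apply: le_trans (normc_sum _ _ _) _.
under eq_bigr do rewrite ComplexField.Normc.normcM !normcX z1 w1 !expr1n mulr1.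
by rewrite sumr_const card_ord.
Qed.

(** While the powers stay within 1/2 of each other, every term of the geometric sum [a] is within
    1/2 of [w ^+ Q.-1], so [a] has modulus at least [Q / 2]. *)
Lemma normc_subX_ge z w Q :
  normc z = 1 -> normc w = 1 ->
  (forall q, (q < Q)%N -> normc (z ^+ q - w ^+ q) <= 1 / 2) ->
  Q%:R / 2 * normc (z - w) <= normc (z ^+ Q - w ^+ Q).
Proof.
move=> z1 w1 small; rewrite subrXX ComplexField.Normc.normcM mulrC.
rewrite ler_wpM2l ?normc_ge0 //.
set a := \sum_(i < Q) _; pose b := \sum_(i < Q) w ^+ (Q.-1 - i) * w ^+ i.
have nb : normc b = Q%:R.
  have -> : b = w ^+ Q.-1 *+ Q.
    rewrite -{2}(card_ord Q) -sumr_const; apply: eq_bigr => i _.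
    by rewrite -exprD subnK //; have := ltn_ord i; lia.
  by rewrite normcMn normcX w1 expr1n.
have nba : normc (b - a) <= Q%:R / 2.
  rewrite /a /b -sumrB; apply: le_trans (normc_sum _ _ _) _.
  rewrite -[Q in Q%:R](card_ord Q) mulr_natl -sumr_const; apply: ler_sum => i _.
  rewrite -mulrBl ComplexField.Normc.normcM.
  rewrite normcX w1 expr1n mulr1 normcB -div1r small //.
  by have := ltn_ord i; lia.
have := le_normcD a (b - a); rewrite addrC subrK nb; lra.
Qed.

(** If all powers up to [Q] stayed within 1/2, the preceding lower bound at exponent [Q] would
    already exceed 1/2. *)
Lemma exists_separating_power z w Q :
  normc z = 1 -> normc w = 1 -> 1 < Q%:R * normc (z - w) ->
  exists2 q, (q <= Q)%N & 1 / 2 < normc (z ^+ q - w ^+ q).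
Proof.
move=> z1 w1 big; apply/boolp.not_exists2P => small.
have {}small q : (q <= Q)%N -> normc (z ^+ q - w ^+ q) <= 1 / 2.
  by move=> qQ; case: (small q) => // /negP; rewrite -leNgt.
have := normc_subX_ge z1 w1 (fun q qQ => small q (ltnW qQ)).
have := small Q (leqnn Q); lra.
Qed.

(* The constant term of the induction on [s] is the kernel
   [(1 / T) \sum_(t < T) (X / z) ^ t], which brings in the gain [1 / T]. *)
Lemma exists_interpolant (I : eqType) (s : seq I) (y : I -> R[i])
    (q : I -> nat) (beta : I -> R) (Q T : nat) z :
  (0 < T)%N -> normc z = 1 ->
  (forall l, l \in s -> [/\ normc (y l) = 1, (q l <= Q)%N,
     0 < normc (z ^+ q l - y l ^+ q l) &
     2 <= beta l * normc (z ^+ q l - y l ^+ q l)]) ->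
  exists p : {poly R[i]},
    [/\ (size p <= T + Q * size s)%N,
        forall n, normc p`_n <= (\prod_(l <- s) beta l) / T%:R,
        p.[z] = 1,
        forall l, l \in s -> p.[y l] = 0
      & forall w B, normc w = 1 -> 0 <= B ->
          (forall l, l \in s -> normc (w ^+ q l - y l ^+ q l) <=
             B * normc (z ^+ q l - y l ^+ q l)) ->
          normc p.[w] <= B ^+ size s].
Proof.
move=> T0 z1; have Tn0 : T%:R != 0 :> R[i] by rewrite pnatr_eq0 -lt0n.
have TR0 : 0 < T%:R :> R by rewrite ltr0n.
have zn0 : z != 0.
  by apply: contra_eq_neq z1 => ->; rewrite ComplexField.Normc.normc0 eq_sym oner_eq0.
have nT : normc (T%:R : R[i]) = T%:R.
  by rewrite -[T%:R]/(1 *+ T) normcMn ComplexField.Normc.normc1.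
elim: s => [_|l s IHs hs].
  have cD t : normc (T%:R^-1 * z ^- t) = T%:R^-1.
    rewrite ComplexField.Normc.normcM !ComplexField.Normc.normcV normcX z1.
    by rewrite nT expr1n invr1 mulr1.
  exists (\poly_(t < T) (T%:R^-1 * z ^- t)); split => //.
  - by rewrite muln0 addn0 size_poly.
  - move=> n; rewrite big_nil coef_poly; case: ifP => _; first by rewrite cD mul1r.
    by rewrite ComplexField.Normc.normc0 mul1r invr_ge0 ltW.
  - rewrite horner_poly; under eq_bigr do rewrite mulfVK ?expf_neq0 //.
    by rewrite sumr_const card_ord -[_ *+ T]mulr_natl mulfV.
  - move=> w B w1 _ _; rewrite horner_poly; apply: le_trans (normc_sum _ _ _) _.
    under eq_bigr do rewrite ComplexField.Normc.normcM cD normcX w1 expr1n mulr1.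
    by rewrite sumr_const card_ord -[_ *+ T]mulr_natl mulfV // pnatr_eq0 -lt0n.
have [|p [szp cp pz py pw]] := IHs.
  by move=> k ks; apply: hs; rewrite inE ks orbT.
have [yl1 qlQ den0 bden] := hs l (mem_head _ _).
set den := z ^+ q l - y l ^+ q l in den0 bden *.
have denn0 : den != 0.
  by apply: contraTneq den0 => ->; rewrite ComplexField.Normc.normc0 ltxx.
(* The new factor equals 1 at [z] and vanishes at [y l]. *)
pose g : {poly R[i]} := den^-1 *: ('X^(q l) - (y l ^+ q l)%:P).
have gE w : g.[w] = (w ^+ q l - y l ^+ q l) / den.
  by rewrite /g !hornerE mulrC.
exists (g * p); split.
- rewrite /g -scalerAl; apply: leq_trans (size_scale_leq _ _) _.
  apply: leq_trans (size_polyMleq _ _) _.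
  have : (size ('X^(q l) - (y l ^+ q l)%:P : {poly R[i]})%R <= (q l).+1)%N.
    apply: leq_trans (size_polyD _ _) _; rewrite size_polyN size_polyXn geq_max leqnn.
    by apply: leq_trans (size_polyC_leq1 _) _.
  move: szp => /=; nia.
- move=> n; have b0 : 0 <= (\prod_(l <- s) beta l) / T%:R.
    by apply: le_trans (cp 0); exact: normc_ge0.
  (* [g] has only two terms, with coefficients of modulus [1 / normc den], so multiplication by it
     enlarges the coefficient bound by at most [2 / normc den <= beta l]. *)
  rewrite big_cons -mulrA /g -scalerAl coefZ mulrBl coefB coefXnM coefCM.
  rewrite ComplexField.Normc.normcM ComplexField.Normc.normcV.
  rewrite mulrC ler_pdivrMr // mulrAC.
  have ? : normc (if (n < q l)%N then 0 else p`_(n - q l)) <= (\prod_(l <- s) beta l) / T%:R.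
    by case: ifP => _ //; rewrite ComplexField.Normc.normc0.
  have ? : normc (y l ^+ q l * p`_n) <= (\prod_(l <- s) beta l) / T%:R.
    by rewrite ComplexField.Normc.normcM normcX yl1 expr1n mul1r.
  apply: le_trans (le_normcD _ _) _; rewrite normcN.
  apply: (@le_trans _ _ (2 * ((\prod_(l <- s) beta l) / T%:R))); first lra.
  by rewrite ler_wpM2r.
- by rewrite hornerM pz mulr1 gE mulfV.
- move=> k; rewrite inE hornerM => /predU1P[->|/py ->]; last by rewrite mulr0.
  by rewrite gE subrr !mul0r.
move=> w B w1 B0 hB; rewrite hornerM ComplexField.Normc.normcM exprS.
rewrite ler_pM ?normc_ge0 //.
  rewrite gE ComplexField.Normc.normcM ComplexField.Normc.normcV ler_pdivrMr //.
  by apply: hB; rewrite mem_head.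
by apply: pw => // k ks; apply: hB; rewrite inE ks orbT.
Qed.

End Interpolation.

(** * Upper bounds *)

Lemma leq_bin_exp n m : ('C(n, m) <= n ^ m)%N.
Proof.
apply: (@leq_trans (n ^_ m)).
  by rewrite -bin_ffact leq_pmulr ?fact_gt0.
elim: m => [|m IHm]; first by rewrite ffactn0.
by rewrite ffactnSr expnSr leq_mul ?leq_subr.
Qed.

Lemma sum_geometric_le2 (R : realFieldType) (x : R) (L : nat) :
  0 <= x -> x <= 1 / 2 -> \sum_(i < L) x ^+ i <= 2.
Proof.
(* Subtracting [2 * x ^+ L] makes the bound inductive, because [x <= 1 / 2]. *)
move=> x0 x2; suff : \sum_(i < L) x ^+ i <= 2 - 2 * x ^+ L.
  by have := exprn_ge0 L x0; lra.
elim: L => [|L IHL]; first by rewrite big_ord0 expr0; lra.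
by rewrite big_ord_recr exprS /=; have := exprn_ge0 L x0; nra.
Qed.

Lemma sqr_sum_le (R : realFieldType) (m : nat) (a : 'I_m -> R) :
  (\sum_i a i) ^+ 2 <= m%:R * \sum_i a i ^+ 2.
Proof.
case: m a => [|m] a; first by rewrite !big_ord0 expr0n mulr0.
set s := \sum_i a i; set M : R := m.+1%:R.
have M0 : 0 < M by rewrite ltr0n.
have : 0 <= \sum_i (M * a i - s) ^+ 2 by apply: sumr_ge0 => i _; apply: sqr_ge0.
have -> : \sum_i (M * a i - s) ^+ 2 =
    \sum_i (M ^+ 2 * a i ^+ 2 + ((- (2 * M * s)) * a i + s ^+ 2)).
  by apply: eq_bigr => i _; ring.
rewrite !big_split /= -!mulr_sumr -/s sumr_const card_ord -[_ *+ m.+1]mulr_natl -/M.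
have -> : M ^+ 2 * \sum_i a i ^+ 2 + (- (2 * M * s) * s + s * (M * s)) =
  M * (M * \sum_i a i ^+ 2 - s ^+ 2) by ring.
by rewrite pmulr_rge0 // subr_ge0.
Qed.

Section Estimates.
Variables (R : rcfType) (S : nat) (K : finType).
Variables (z : 'I_S -> R[i]) (kap : 'I_S -> K) (r : 'I_S -> nat).
Hypothesis r_onto : forall i m, (m <= r i)%N ->
  exists2 j, kap j = kap i & r j = m.

Definition power_matrix N : 'M[R[i]]_(N.+1, S) := \matrix_(k < N.+1, j < S) z j ^+ k.

(** In the binomial expansion of [y = w + (y - w)], the term of order [m] is at most [(N h) ^ m], so
    the tail is dominated by a geometric series of ratio at most 1/2. *)
Lemma taylor_remainder (h : R) (w y : R[i]) n N p :
  (n <= N)%N -> normc w = 1 -> normc (y - w) <= h -> N%:R * h <= 1 / 2 ->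
  normc (y ^+ n - \sum_(m < p) (w ^+ (n - m) * (y - w) ^+ m) *+ 'C(n, m)) <=
    2 * (N%:R * h) ^+ p.
Proof.
move=> nN w1 yw Nh; pose a m := (w ^+ (n - m) * (y - w) ^+ m) *+ 'C(n, m).
have h0 : 0 <= h by apply: le_trans yw; exact: normc_ge0.
have x0 : 0 <= N%:R * h by rewrite mulr_ge0 ?ler0n.
(* Padding with vanishing binomials up to [p + n.+1] terms lets the first [p] be split off even when
   [p > n]. *)
have -> : y ^+ n = \sum_(m < p + n.+1) a m.
  rewrite -(big_mkord xpredT a) addnC big_mkord big_split_ord /=.
  rewrite [X in _ + X]big1 ?addr0 => [|i _].
    by rewrite -{1}(subrK w y) addrC exprDn.
  by rewrite /a bin_small ?mulr0n // ltn_addr.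
rewrite big_split_ord /= addrAC subrr add0r.
apply: le_trans (normc_sum _ _ _) _.
apply: (@le_trans _ _ (\sum_(i < n.+1) (N%:R * h) ^+ p * (N%:R * h) ^+ i)).
  apply: ler_sum => i _; rewrite /a normcMn ComplexField.Normc.normcM !normcX w1 expr1n mul1r.
  rewrite -exprD exprMn -[_ *+ 'C(_, _)]mulr_natl ler_pM ?ler0n ?exprn_ge0 ?normc_ge0 //.
    rewrite -natrX ler_nat; apply: leq_trans (leq_bin_exp _ _) _.
    by case: (p + i)%N => // e; rewrite leq_exp2r.
  by rewrite lerXn2r ?nnegrE ?normc_ge0.
rewrite -mulr_sumr mulrC ler_wpM2r ?exprn_ge0 //.
exact: sum_geometric_le2.
Qed.

Lemma power_matrix_mulE N (u : 'cV[R[i]]_S) n :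
  (power_matrix N *m u) n 0 = \sum_i z i ^+ n * u i 0.
Proof. by rewrite mxE; apply: eq_bigr => i _; rewrite mxE. Qed.

Section Upper.
Variables (N : nat) (h : R) (w : K -> R[i]).
Hypothesis w1 : forall k, normc (w k) = 1.
Hypothesis zw : forall i, normc (z i - w (kap i)) <= h.
Hypothesis N0 : (0 < N)%N.
Hypothesis Nh : N%:R * h <= 1 / 2.

(* A cluster with at most [p] nodes contributes one equation [u i = 0] per node,
   a larger one its first [p] moment equations. *)
Definition moment_functional p (i : 'I_S) : 'rV[R[i]]_S :=
  if [exists j, (kap j == kap i) && (p <= r j)%N]
  then \row_j ((z j - w (kap i)) ^+ r i *+ (kap j == kap i))
  else delta_mx 0 i.

(** In a cluster with more than [p] nodes, the node of rank [m], supplied by [r_onto], indexes the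
    moment equation of order [m]. In a smaller cluster every coordinate of [u] is zero. *)
Lemma moments_vanish p (u : 'cV[R[i]]_S) k m :
  (forall i, (r i < p)%N -> moment_functional p i *m u = 0) -> (m < p)%N ->
  \sum_(i | kap i == k) (z i - w k) ^+ m * u i 0 = 0.
Proof.
move=> fu mp; case: (boolP [exists j, (kap j == k) && (p <= r j)%N]) => [|nj].
  case/existsP=> j /andP[/eqP jk pj].
  have [i ij rim] := r_onto (leq_trans (ltnW mp) pj).
  have := fu i; rewrite rim mp => /(_ isT).
  rewrite /moment_functional ifT; last first.
    by apply/existsP; exists j; rewrite ij pj eqxx.
  move=> /(congr1 (fun A : 'cV_1 => A 0 0)); rewrite !mxE ij jk rim => E.
  rewrite -[RHS]E [LHS]big_mkcond; apply: eq_bigr => l _; rewrite mxE.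
  by case: eqP => _; rewrite ?mulr1n // mulr0n mul0r.
apply: big1 => i /eqP ik; have rip : (r i < p)%N.
  by rewrite ltnNge; apply: contra nj => pi; apply/existsP; exists i; rewrite ik eqxx.
have := fu i rip; rewrite /moment_functional ik (negPf nj).
move=> /(congr1 (fun A : 'cV_1 => A 0 0)); rewrite -rowE !mxE => ->.
by rewrite mulr0.
Qed.

Lemma power_matrix_mul_le p (u : 'cV[R[i]]_S) n :
  (forall i, (r i < p)%N -> moment_functional p i *m u = 0) ->
  normc ((power_matrix N *m u) n 0) <=
    2 * (N%:R * h) ^+ p * \sum_i normc (u i 0).
Proof.
(* The truncated Taylor expansion at the cluster centre involves only the first [p] moments, so it
   contributes nothing and only the remainder is left. *)
move=> fu; pose q i := \sum_(m < p)
  (w (kap i) ^+ (n - m) * (z i - w (kap i)) ^+ m) *+ 'C(n, m).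
have q0 : \sum_i q i * u i 0 = 0.
  under eq_bigr do rewrite mulr_suml.
  rewrite exchange_big big1 //= => m _.
  rewrite (partition_big kap xpredT) //= big1 // => k _.
  transitivity (w k ^+ (n - m) *+ 'C(n, m) *
      \sum_(i | kap i == k) (z i - w k) ^+ m * u i 0).
    rewrite mulr_sumr; apply: eq_bigr => i /eqP ->.
    by rewrite -mulrnAl mulrA.
  by rewrite (moments_vanish k fu) // mulr0.
have -> : (power_matrix N *m u) n 0 = \sum_i (z i ^+ n - q i) * u i 0.
  rewrite power_matrix_mulE; under [RHS]eq_bigr do rewrite mulrBl.
  by rewrite sumrB q0 subr0.
apply: le_trans (normc_sum _ _ _) _; rewrite mulr_sumr; apply: ler_sum => i _.
rewrite ComplexField.Normc.normcM ler_wpM2r ?normc_ge0 //.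
by apply: taylor_remainder => //; rewrite -ltnS.
Qed.

Lemma power_matrix_normsq_le p (u : 'cV[R[i]]_S) :
  (forall i, (r i < p)%N -> moment_functional p i *m u = 0) ->
  normsq (power_matrix N *m u) <=
    (3 * S%:R * (Num.sqrt N%:R * (N%:R * h) ^+ p)) ^+ 2 * normsq u.
Proof.
move=> fu; set s := \sum_i normc (u i 0).
have le_s n : normc ((power_matrix N *m u) n 0) <= 2 * (N%:R * h) ^+ p * s.
  exact: power_matrix_mul_le.
move: (N%:R * h) le_s => x le_s.
have s2 : s ^+ 2 <= S%:R * normsq u by exact: sqr_sum_le.
have s0 : 0 <= s by apply: sumr_ge0 => i _; apply: normc_ge0.
have xp0 : 0 <= x ^+ p ^+ 2 by exact: sqr_ge0.
apply: (@le_trans _ _ (\sum_(n < N.+1) (2 * x ^+ p * s) ^+ 2)).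
  apply: ler_sum => n _; rewrite lerXn2r ?nnegrE ?normc_ge0 //.
  by apply: le_trans (le_s n); exact: normc_ge0.
rewrite sumr_const card_ord -[_ *+ N.+1]mulr_natl !exprMn sqr_sqrtr ?ler0n //.
have N1 : N.+1%:R <= 2 * N%:R :> R by rewrite -natrM ler_nat; lia.
have S1 : S%:R <= S%:R ^+ 2 :> R by rewrite -natrX ler_nat; nia.
set M := N.+1%:R in N1 *; have M0 : 0 <= M by exact: ler0n.
have nu := normsq_ge0 u.
(* The sum is at most [2 N * 4 * S ^ 2] times the remaining factors, and [8 <= 3 ^ 2] yields the
   constant [3 * S]. *)
apply: (@le_trans _ _ (2 * N%:R * (4 * x ^+ p ^+ 2 * (S%:R ^+ 2 * normsq u)))).
  have pos : 0 <= 2 ^+ 2 * x ^+ p ^+ 2 * s ^+ 2.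
    by apply: mulr_ge0; [apply: mulr_ge0 => //; lra|exact: sqr_ge0].
  apply: ler_pM => //.
  have -> : 2 ^+ 2 = 4 :> R by rewrite -natrX.
  apply: ler_wpM2l; first by apply: mulr_ge0 => //; lra.
  by apply: le_trans s2 _; rewrite ler_wpM2r.
have : 0 <= x ^+ p ^+ 2 * (S%:R ^+ 2 * normsq u) * N%:R.
  by rewrite mulr_ge0 // mulr_ge0 // mulr_ge0 // sqr_ge0.
lra.
Qed.

End Upper.

End Estimates.

(** * Lower bounds *)

(** The highest ranks are bounded first. Each descent to a lower rank costs a factor [1 + n * b],
    and there are at most [n] levels. *)
Lemma back_substitution (R : realFieldType) (n : nat) (r : 'I_n -> nat)
    (y : 'I_n -> R) (eps b : R) :
  (forall i, (r i < n)%N) -> 0 <= eps -> 0 <= b ->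
  (forall i, y i <= eps + b * \sum_(l | (r i < r l)%N) y l) ->
  forall i, y i <= eps * (1 + n%:R * b) ^+ n.
Proof.
move=> rn eps0 b0 hy.
have nb0 : 0 <= n%:R * b by rewrite mulr_ge0 ?ler0n.
have q1 : 1 <= 1 + n%:R * b by lra.
suff Hd d i : (n - r i <= d)%N -> y i <= eps * (1 + n%:R * b) ^+ d.
  by move=> i; apply: Hd; rewrite leq_subr.
elim: d i => [|d IHd] i rid.
  by have := rn i; rewrite -subn_gt0; case: (n - r i)%N rid.
apply: le_trans (hy i) _; set e := eps * (1 + n%:R * b) ^+ d.
have e0 : eps <= e by rewrite ler_peMr // exprn_ege1.
have sum_le : \sum_(l | (r i < r l)%N) y l <= n%:R * e.
  apply: (@le_trans _ _ (\sum_(l | (r i < r l)%N) e)).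
    apply: ler_sum => l ril; apply: IHd.
    by have := rn i; have := rn l; move: rid ril; lia.
  apply: (@le_trans _ _ (\sum_(l < n) e)).
    rewrite big_mkcond; apply: ler_sum => l _; case: ifP => // _.
    exact: le_trans eps0 e0.
  by rewrite sumr_const card_ord -[e *+ n]mulr_natl.
have := ler_wpM2l b0 sum_le.
have -> : eps * (1 + n%:R * b) ^+ d.+1 = e + b * (n%:R * e).
  by rewrite exprS /e; ring.
by move: e0; lra.
Qed.

Section Lower.
Variables (R : rcfType) (S : nat) (K : finType).
Variables (z : 'I_S -> R[i]) (kap : 'I_S -> K) (r : 'I_S -> nat).
Hypothesis z1 : forall i, normc (z i) = 1.
Hypothesis rS : forall i, (r i < S)%N.
Hypothesis r_inj : forall i j, kap i = kap j -> r i = r j -> i = j.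
Variables (N : nat) (t h theta : R).
Hypothesis t0 : 0 < t.
Hypothesis h0 : 0 < h.
Hypothesis N0 : (0 < N)%N.
Hypothesis SN : (S <= N.+1)%N.
Hypothesis Nh : N%:R * h <= 1 / 2.
Hypothesis Ntheta : 2 * S%:R <= N%:R * theta.
Hypothesis z_le : forall i j, kap i = kap j -> normc (z i - z j) <= h.
Hypothesis z_ge : forall i j, kap i = kap j -> i != j -> t * h <= normc (z i - z j).
Hypothesis z_sep : forall i j, kap i != kap j -> theta <= normc (z i - z j).

Let x := N%:R * h.
(** The summand 4 compensates denominators above 1/2 from other clusters. The summand [8 S / t]
    compensates [Q / 2 * (t * h)] within a cluster, through [N < 2 * S * Q]. *)
Let B : R := 4 + 8 * S%:R / t.
Let Q := (N.+1 %/ S)%N.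

Let NR0 : 0 < N%:R :> R. Proof. by rewrite ltr0n. Qed.
Let x0 : 0 < x. Proof. by rewrite mulr_gt0. Qed.

Lemma step_bounds (i : 'I_S) :
  [/\ (0 < Q)%N, (Q * S <= N.+1)%N & N%:R < 2 * S%:R * Q%:R :> R].
Proof.
have S0 : (0 < S)%N by apply: leq_ltn_trans (ltn_ord i).
split; rewrite /Q ?divn_gt0 //; first exact: leq_divM.
rewrite -!natrM ltr_nat; have := divn_eq N.+1 S; have := ltn_pmod N.+1 S0.
have := SN; rewrite -(divn_gt0 _ S0); nia.
Qed.

(** Exponents below [Q] move two nodes of one cluster apart by at most [N * h <= 1 / 2], so the
    chord still grows linearly up to [Q]. *)
Lemma same_cluster_power (i l : 'I_S) :
  kap l = kap i -> l != i -> Q%:R / 2 * (t * h) <= normc (z i ^+ Q - z l ^+ Q).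
Proof.
move=> li lni; have [Q0 QS _] := step_bounds i.
apply: le_trans (normc_subX_ge (z1 i) (z1 l) _).
  by rewrite ler_wpM2l ?divr_ge0 ?ler0n // z_ge // eq_sym.
move=> q qQ; apply: le_trans (normc_subX_le _ (z1 i) (z1 l)) _.
apply: le_trans Nh; apply: ler_pM => //; rewrite ?ler0n ?normc_ge0 ?z_le //.
rewrite ler_nat; have := ltn_ord i; nia.
Qed.

(* [S] factors of degree at most [Q] fit into degree [N]; to stay away from [0],
   the factor of a node in another cluster uses its own exponent. *)
Lemma lower_interpolant (i : 'I_S) : exists p : {poly R[i]},
  [/\ (size p <= N.+1)%N,
      forall n, normc p`_n <= B ^+ S * x^-1 ^+ r i * (2 * S%:R / N%:R),
      p.[z i] = 1,
      forall l, (kap l != kap i) || (r l < r i)%N -> p.[z l] = 0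
    & forall l, kap l = kap i -> normc p.[z l] <= B ^+ S].
Proof.
have [Q0 QS NQ] := step_bounds i.
have S0 : 0 < S%:R :> R by rewrite ltr0n; apply: leq_ltn_trans (ltn_ord i).
have QR0 : 0 < Q%:R :> R by rewrite ltr0n.
have St0 : 0 < S%:R / t by rewrite divr_gt0.
have B1 : 1 <= B by rewrite /B; lra.
have x1 : 1 <= x^-1 by rewrite invf_ge1 //; move: Nh; rewrite -/x; lra.
have [q hq] : exists q : 'I_S -> nat, forall l, (q l <= Q)%N /\
    if kap l == kap i then q l = Q else 1 / 2 < normc (z i ^+ q l - z l ^+ q l).
  apply: (fin_all_exists (P := fun l q => (q <= Q)%N /\
    if kap l == kap i then q = Q else 1 / 2 < normc (z i ^+ q - z l ^+ q))) => l.
  case: eqP => [|/eqP li]; first by exists Q.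
  have [|q qQ hq] := exists_separating_power (Q := Q) (z1 i) (z1 l); last by exists q.
  (* [1 < Q * theta] follows from [2 S <= N * theta] and [N < 2 * S * Q]. *)
  apply: (@lt_le_trans _ _ (Q%:R * theta)); last first.
    by rewrite ler_wpM2l ?ler0n // z_sep // eq_sym.
  have S2 : 0 < 2 * S%:R :> R by rewrite mulr_gt0.
  have th0 : 0 < theta by rewrite -(pmulr_rgt0 _ NR0) (lt_le_trans S2).
  rewrite -(ltr_pM2l S2) mulr1 mulrA; apply: le_lt_trans Ntheta _.
  by rewrite ltr_pM2r.
pose s := [seq l <- enum 'I_S | (kap l != kap i) || (r l < r i)%N].
have memS l : (l \in s) = (kap l != kap i) || (r l < r i)%N.
  by rewrite mem_filter mem_enum andbT.
(* The node [i] itself is absent from [s], which leaves one block of length [Q] for the averaged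
   geometric sum. *)
have ltsS : (size s < S)%N.
  rewrite -[S in (_ < S)%N]size_enum_ord /s size_filter.
  rewrite -(count_predC (fun l => (kap l != kap i) || (r l < r i)%N) (enum 'I_S)).
  rewrite -[X in (X < _)%N]addn0 ltn_add2l -has_count; apply/hasP.
  by exists i; rewrite ?mem_enum //= eqxx ltnn.
(* Only factors from the cluster of [i] cost a power of [x^-1]. *)
pose beta l := B * (if kap l == kap i then x^-1 else 1).
have B0 : 0 <= B by lra.
have den l : l \in s -> 0 < normc (z i ^+ q l - z l ^+ q l) /\
    2 <= beta l * normc (z i ^+ q l - z l ^+ q l).
  rewrite memS; case: (hq l) => _; rewrite /beta; case: eqP => [li ->|_ den _] /=.
    move=> rli; have lni : l != i by apply: contraTneq rli => ->; rewrite ltnn.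
    have := same_cluster_power li lni; set D := normc _ => Dge.
    have th0 : 0 < t * h by rewrite mulr_gt0.
    have Dpos : 0 < D by apply: lt_le_trans Dge; rewrite mulr_gt0 ?divr_gt0.
    split=> //; rewrite mulrAC ler_pdivlMr //.
    apply: (@le_trans _ _ (8 * S%:R / t * (Q%:R / 2 * (t * h)))).
      have -> : 8 * S%:R / t * (Q%:R / 2 * (t * h)) = 2 * ((2 * S%:R * Q%:R) * h).
        by field; rewrite gt_eqF.
      by rewrite ler_pM2l // /x ler_wpM2r ?ltW.
    have St8 : 8 * S%:R / t = 8 * (S%:R / t) by rewrite mulrA.
    apply: ler_pM => //; first by rewrite St8; lra.
      by rewrite ltW // mulr_gt0 // divr_gt0.
    by rewrite /B; lra.
  have BD : 4 * (1 / 2) <= B * normc (z i ^+ q l - z l ^+ q l).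
    by apply: ler_pM => //; rewrite ?/B; lra.
  by split; lra.
have [|p [szp cp pz py pw]] :=
    @exists_interpolant R _ s z q beta Q Q (z i) Q0 (z1 i).
  by move=> l ls; have [] := den l ls; have [] := hq l; split.
exists p; split=> //.
- apply: leq_trans szp _; rewrite -mulnS; apply: leq_trans QS.
  by rewrite leq_mul2l ltsS orbT.
- move=> n; apply: le_trans (cp n) _.
  have Eb : \prod_(l <- s) beta l = B ^+ size s * x^-1 ^+ count (fun l => kap l == kap i) s.
    rewrite big_split /=; congr (_ * _).
      by rewrite big_const_seq count_predT iter_mulr_1.
    by rewrite -big_mkcond big_const_seq iter_mulr_1.
  rewrite Eb; apply: ler_pM.
  + by rewrite mulr_ge0 ?exprn_ge0 // ltW // (lt_le_trans ltr01).
  + by rewrite invr_ge0 ler0n.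
  + apply: ler_pM; rewrite ?exprn_ge0 //; first by rewrite (le_trans ler01).
      by rewrite ler_weXn2l // ltnW.
    rewrite ler_weXn2l //.
    (* These factors belong to nodes of distinct ranks below [r i], so there are at most [r i] of
       them. *)
    rewrite -size_filter -(size_map r) -(size_iota 0 (r i)); apply: uniq_leq_size.
      rewrite map_inj_in_uniq; first by do 2 apply: filter_uniq; exact: enum_uniq.
      move=> a b.
      rewrite !mem_filter => /andP[/eqP ai _] /andP[/eqP bi _].
      by apply: r_inj; rewrite ai bi.
    move=> _ /mapP[l + ->]; rewrite !mem_filter => /and3P[/eqP -> + _].
    by rewrite eqxx mem_iota.
  + by rewrite ler_pdivlMr // mulrC ler_pdivrMr // ltW.
- by move=> l; rewrite -memS; apply: py.
(* At a node of the same cluster each factor is at most [B]: a numerator at most [Q * h] against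
   [Q / 2 * (t * h)], or at most 2 against a denominator above 1/2. *)
move=> l li; apply: le_trans (pw (z l) B (z1 l) B0 _) _; last first.
  by rewrite ler_weXn2l // ltnW.
move=> k ks; have [den0 _] := den k ks; move: ks; rewrite memS.
case: (hq k) => _; case: eqP => [ki qQ /= rki|_ qk _].
  have kni : k != i by apply: contraTneq rki => ->; rewrite ltnn.
  rewrite qQ; apply: le_trans (normc_subX_le _ (z1 l) (z1 k)) _.
  apply: (@le_trans _ _ (B * (Q%:R / 2 * (t * h)))); last first.
    by rewrite ler_wpM2l // same_cluster_power.
  apply: (@le_trans _ _ (Q%:R * h)).
    by rewrite ler_wpM2l ?ler0n // z_le // li ki.
  have -> : B * (Q%:R / 2 * (t * h)) = Q%:R * h * (2 * t + 4 * S%:R).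
    by rewrite /B; field; rewrite gt_eqF.
  have S1 : 1 <= S%:R :> R by rewrite ler1n; apply: leq_ltn_trans (ltn_ord i).
  by rewrite ler_peMr ?mulr_ge0 ?ltW //; move: t0; lra.
apply: (@le_trans _ _ (4 * (1 / 2))); last first.
  by apply: ler_pM => //; rewrite /B; lra.
apply: le_trans (le_normcD _ _) _.
by rewrite normcN !normcX !z1 !expr1n; lra.
Qed.

(** The inverse of the accumulated losses: [2 S] and [B ^+ S] from the coefficients, 2 from
    Cauchy-Schwarz over [N.+1] entries, the back-substitution factor, and [S] from passing from the
    maximum of the entries of [u] to its norm. *)
Definition lower_constant : R := (4 * S%:R ^+ 2 * (B ^+ S * (1 + S%:R * B ^+ S) ^+ S))^-1.

Lemma power_matrix_normsq_ge : exists f : 'I_S -> 'rV[R[i]]_S,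
  forall p (u : 'cV[R[i]]_S), (forall i, (p < r i)%N -> f i *m u = 0) ->
  (lower_constant * (Num.sqrt N%:R * x ^+ p)) ^+ 2 * normsq u <=
    normsq (power_matrix z N *m u).
Proof.
have [P hP] := fin_all_exists lower_interpolant.
(* Evaluating [P i] at the nodes pairs its coefficients with [V u]. The same family serves every
   [p]. *)
exists (fun i => \row_l (P i).[z l]) => p u fu.
have [S0|S0] := posnP S.
  have -> : normsq u = 0.
    by apply: big1 => i _; have := ltn_ord i; rewrite {2}S0.
  by rewrite mulr0 normsq_ge0.
have SR0 : 0 < S%:R :> R by rewrite ltr0n.
set v := power_matrix z N *m u.
set sv := Num.sqrt (normsq v).
have sv0 : 0 <= sv by rewrite sqrtr_ge0.
have sN0 : 0 < Num.sqrt (N%:R : R) by rewrite sqrtr_gt0.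
have sNN : Num.sqrt (N%:R : R) ^+ 2 = N%:R by rewrite sqr_sqrtr ?ler0n.
have sum_v : \sum_n normc (v n 0) <= 2 * Num.sqrt N%:R * sv.
  have v0 : 0 <= \sum_n normc (v n 0) by apply: sumr_ge0 => n _; exact: normc_ge0.
  have sNsv0 : 0 <= 2 * Num.sqrt N%:R * sv by rewrite mulr_ge0 // mulr_ge0 // ltW.
  rewrite -(@ler_pXn2r _ 2) ?nnegrE //.
  apply: le_trans (sqr_sum_le _) _; rewrite -/(normsq v).
  rewrite !exprMn sNN sqr_sqrtr ?normsq_ge0 //.
  rewrite ler_wpM2r ?normsq_ge0 // -natrX -natrM ler_nat.
  by rewrite -addn1 -[(2 ^ 2)%N]/4%N mulSn leq_add2l muln_gt0.
have B0 : 0 <= B by rewrite addr_ge0 // divr_ge0 ?mulr_ge0 ?ler0n ?ltW.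
have BS0 : 0 <= B ^+ S by rewrite exprn_ge0.
have x1 : 1 <= x^-1 by rewrite invf_ge1 //; move: Nh; rewrite -/x; lra.
set eps := B ^+ S * x^-1 ^+ p * (2 * S%:R / N%:R) * (2 * Num.sqrt N%:R * sv).
have x10 : 0 <= x^-1 by rewrite invr_ge0 ltW.
have SN0 : 0 <= 2 * S%:R / N%:R :> R by rewrite divr_ge0 ?mulr_ge0 ?ler0n.
have eps0 : 0 <= eps.
  apply: mulr_ge0; first by rewrite mulr_ge0 // mulr_ge0 // exprn_ge0.
  by rewrite mulr_ge0 // mulr_ge0 // ltW.
(* For rank above [p] the functional vanishes. Otherwise [x^-1 >= 1] lets the power [r i] be raised
   to [p] in the coefficient bound. *)
have f_le i : normc (\sum_l (P i).[z l] * u l 0) <= eps.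
  have [pri|rip] := ltnP p (r i).
    have := congr1 (fun A : 'cV_1 => A 0 0) (fu i pri).
    rewrite !mxE; under eq_bigr do rewrite mxE.
    by move=> ->; rewrite ComplexField.Normc.normc0.
  have [szP cP _ _ _] := hP i.
  have -> : \sum_l (P i).[z l] * u l 0 = \sum_(n < N.+1) (P i)`_n * v n 0.
    under eq_bigr do rewrite (horner_coef_wide _ szP) mulr_suml.
    rewrite exchange_big; apply: eq_bigr => n _.
    rewrite power_matrix_mulE mulr_sumr.
    by apply: eq_bigr => l _; rewrite mulrA.
  apply: le_trans (normc_sum _ _ _) _.
  apply: (@le_trans _ _ (\sum_(n < N.+1)
      B ^+ S * x^-1 ^+ p * (2 * S%:R / N%:R) * normc (v n 0))).
    apply: ler_sum => n _; rewrite ComplexField.Normc.normcM.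
    apply: ler_wpM2r; first exact: normc_ge0.
    apply: le_trans (cP n) _; apply: ler_wpM2r => //; apply: ler_wpM2l => //.
    by rewrite ler_weXn2l.
  rewrite -mulr_sumr; apply: ler_wpM2l => //.
  by rewrite mulr_ge0 // mulr_ge0 // exprn_ge0.
have u_le i : normc (u i 0) <= eps * (1 + S%:R * B ^+ S) ^+ S.
  apply: (@back_substitution R S r (fun i => normc (u i 0))) => // {}i.
  have [_ _ Pi P0 PB] := hP i.
  (* [P i] kills other clusters and lower ranks and is 1 at [z i], so the system is unitriangular in
     the rank. *)
  have -> : u i 0 = \sum_l (P i).[z l] * u l 0 -
      \sum_(l | (r i < r l)%N) (P i).[z l] * u l 0.
    rewrite (bigID (fun l => (r i < r l)%N)) /= addrAC subrr add0r.
    rewrite (bigD1 i) ?ltnn //= Pi mul1r big1 ?addr0 // => l /andP[ril lni].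
    rewrite P0 ?mul0r //; apply: contraR lni; rewrite negb_or negbK.
    move=> /andP[/eqP li rli]; apply/eqP/r_inj => //.
    by apply/eqP; rewrite eqn_leq leqNgt ril leqNgt rli.
  apply: le_trans (le_normcD _ _) _; rewrite normcN; apply: lerD => //.
  apply: le_trans (normc_sum _ _ _) _; rewrite mulr_sumr.
  apply: ler_sum => l _; rewrite ComplexField.Normc.normcM.
  apply: ler_wpM2r; first exact: normc_ge0.
  have [li|li] := eqVneq (kap l) (kap i); first exact: PB.
  by rewrite P0 ?li // ComplexField.Normc.normc0.
set D := (1 + S%:R * B ^+ S) ^+ S in u_le.
have D1 : 1 <= D by rewrite exprn_ege1 // lerDl mulr_ge0 ?ler0n.
have D0 : 0 <= D by apply: le_trans D1.
have nu_le : normsq u <= (S%:R * (eps * D)) ^+ 2.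
  apply: (@le_trans _ _ (\sum_(i < S) (eps * D) ^+ 2)).
    apply: ler_sum => i _; rewrite lerXn2r ?nnegrE ?normc_ge0 //.
    exact: mulr_ge0.
  rewrite sumr_const card_ord -[_ *+ S]mulr_natl [in leRHS]exprMn.
  apply: ler_wpM2r; first exact: sqr_ge0.
  by rewrite expr2 ler_peMr ?ler0n // ler1n.
have B1 : 0 < B ^+ S.
  by rewrite exprn_gt0 // ltr_wpDr // divr_ge0 ?mulr_ge0 ?ler0n ?ltW.
apply: (@le_trans _ _ ((lower_constant * (Num.sqrt N%:R * x ^+ p)) ^+ 2 *
    (S%:R * (eps * D)) ^+ 2)).
  by apply: ler_wpM2l => //; exact: sqr_ge0.
rewrite -exprMn -[leRHS](@sqr_sqrtr _ (normsq v)) ?normsq_ge0 // -/sv.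
suff -> : lower_constant * (Num.sqrt N%:R * x ^+ p) * (S%:R * (eps * D)) = sv by [].
(* Writing [N] as the square of its root turns the identity into one of rational functions. *)
have cancel_all (b d a n m y : R) :
    b != 0 -> d != 0 -> a != 0 -> n != 0 -> y != 0 -> n ^+ 2 = m ->
    (4 * a ^+ 2 * (b * d))^-1 * (n * y) *
      (a * (b * y^-1 * (2 * a / m) * (2 * n * sv) * d)) = sv.
  by move=> ? ? ? ? ? <-; field; do ?[apply/andP; split].
rewrite /lower_constant /eps exprVn -/D; apply: cancel_all => //.
- by rewrite gt_eqF.
- by rewrite gt_eqF // (lt_le_trans ltr01).
- by rewrite gt_eqF.
- by rewrite gt_eqF.
- by rewrite expf_neq0 // gt_eqF.
Qed.

End Lower.

(** * Chords and wrap-around distance *)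

Section Chord.
Variable R : realType.
Implicit Types a b x y : R.

Lemma normc_expi x : normc (expi x) = 1.
Proof. by rewrite /expi /= cos2Dsin2 sqrtr1. Qed.

Lemma expiD x y : expi (x + y) = expi x * expi y.
Proof. by rewrite /expi cosD sinD; simpc; congr (_ +i* _)%C; rewrite addrC. Qed.

Lemma expi0 : expi (0 : R) = 1.
Proof. by rewrite /expi cos0 sin0. Qed.

Lemma expi_natmul n x : expi (n%:R * x) = expi x ^+ n.
Proof.
elim: n => [|n IHn]; first by rewrite mul0r expi0 expr0.
by rewrite -[n.+1]add1n natrD mulrDl mul1r expiD IHn exprS.
Qed.

Lemma sin_le_id b : 0 <= b -> sin b <= b.
Proof.
move=> b0.
have [|c _] := @MVT_segment R sin cos 0 b b0 (fun x _ => is_derive_sin x).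
  by apply/continuous_subspaceT => ?; exact: continuous_sin.
by rewrite sin0 !subr0 => ->; rewrite ler_piMl // cos_le1.
Qed.

(** If [cos b >= 1 / 4], the mean value theorem gives slope at least 1/4. Otherwise [sin b] is at
    least 1/2, while [b / 4 <= 1 / 2] because [pi / 2 <= 2]. *)
Lemma sin_ge_quarter b : 0 <= b <= pi / 2 -> b / 4 <= sin b.
Proof.
move=> /andP[b0 bpi].
have [/andP[_ pi2] _] := pihalf_02_cos_pihalf R.
have [|c] := @MVT_segment R sin cos 0 b b0 (fun x _ => is_derive_sin x).
  by apply/continuous_subspaceT => ?; exact: continuous_sin.
rewrite sin0 !subr0 in_itv /= => /andP[c0 cb] sinE.
have cosbc : cos b <= cos c.
  have pi0 := pi_gt0 R.
  move: cb; rewrite le_eqVlt => /predU1P[->//|cb].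
  by rewrite ltW // ltr_cos // in_itv /=; lra.
have [cosb|cosb] := leP (1 / 4) (cos b).
  by rewrite sinE; nra.
have cosb0 : 0 <= cos b by apply: cos_ge0_pihalf; have := pi_gt0 R; lra.
have sinb0 : 0 <= sin b by apply: sin_ge0_pi; have := pi_gt0 R; lra.
by have := cos2Dsin2 b; nra.
Qed.

Lemma normc_expi_sub x y : normc (expi x - expi y) = 2 * `|sin ((x - y) / 2)|.
Proof.
have -> : expi x - expi y = expi y * (expi (x - y) - 1).
  by rewrite mulrBr mulr1 -expiD (addrC y) subrK.
rewrite ComplexField.Normc.normcM normc_expi mul1r.
set b := (x - y) / 2; have -> : x - y = b *+ 2 by rewrite -mulr_natr /b mulfVK.
rewrite /expi cos_mulr2n sin_mulr2n; simpc; rewrite /=.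
have cs := cos2Dsin2 b.
transitivity (Num.sqrt ((2 * sin b) ^+ 2)).
  congr Num.sqrt.
  have cE : cos b ^+ 2 = 1 - sin b ^+ 2 by lra.
  have -> : cos b ^+ 2 *+ 2 - 1 - 1 = - (2 * sin b ^+ 2) by rewrite cE; ring.
  have -> : (cos b * sin b *+ 2) ^+ 2 = 4 * cos b ^+ 2 * sin b ^+ 2 by ring.
  by rewrite cE; ring.
by rewrite sqrtr_sqr normrM ger0_norm.
Qed.

Lemma Arg_expi x y : - pi < x <= pi -> - pi < y <= pi ->
  - pi < Arg (expi (x - y)) <= pi /\ expi (x - y) = expi (Arg (expi (x - y))).
Proof.
move=> hx hy; have := pi_gt0 R => pi0.
(* The difference lies strictly between [-2 pi] and [2 pi], so at most one shift by [2 pi] reaches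
   the principal interval. *)
have [a ha Ea] : exists2 a, - pi < a <= pi & expi (x - y) = expi a.
  have e2 b : expi (b + pi *+ 2) = expi b by rewrite /expi cosD2pi sinD2pi.
  case: (lerP (x - y) (- pi)) => h1.
    by exists (x - y + pi *+ 2); [lra|rewrite e2].
  case: (ltrP pi (x - y)) => h2.
    by exists (x - y - pi *+ 2); [lra|rewrite -(e2 (x - y - _)) subrK].
  by exists (x - y) => //; lra.
have [h1 h2] : - pi < Arg (expi (x - y)) <= pi /\
    expi (x - y) = `|expi (x - y)| * expi (Arg (expi (x - y))).
  apply: (xgetPex 0 (P := [set a | - pi < a <= pi /\
    expi (x - y) = `|expi (x - y)| * expi a]%classic)).
  by exists a; split => //; rewrite -normc_norm normc_expi Ea mul1r.
by split=> //; rewrite {1}h2 -normc_norm normc_expi mul1r.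
Qed.

(** The chord is twice the sine of half the wrap-around distance, an angle in [[0, pi / 2]]. *)
Lemma chord_wrap_dist x y : - pi < x <= pi -> - pi < y <= pi ->
  wrap_dist x y / 4 <= normc (expi x - expi y) <= wrap_dist x y.
Proof.
move=> hx hy; have [ha Ea] := Arg_expi hx hy.
rewrite /wrap_dist; set a := Arg _ in ha Ea *.
have -> : normc (expi x - expi y) = normc (expi a - expi 0).
  have -> : expi x - expi y = expi y * (expi (x - y) - 1).
    by rewrite mulrBr mulr1 -expiD (addrC y) subrK.
  by rewrite ComplexField.Normc.normcM normc_expi mul1r Ea expi0.
rewrite normc_expi_sub subr0.
have -> : `|sin (a / 2)| = sin (`|a| / 2).
  have pi0 := pi_gt0 R.
  have sin0 b : 0 <= b <= pi -> `|sin (b / 2)| = sin (b / 2).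
    by move=> hb; rewrite ger0_norm // sin_ge0_pi //; lra.
  have [a0|a0] := leP 0 a; first by rewrite (ger0_norm a0) sin0 //; lra.
  by rewrite (ltr0_norm a0) -(sin0 (- a)) ?mulNr ?sinN ?normrN //; lra.
have na : 0 <= `|a| <= pi.
  by rewrite normr_ge0 ler_norml; lra.
have := @sin_le_id (`|a| / 2); have := @sin_ge_quarter (`|a| / 2).
by lra.
Qed.

End Chord.

(** * Counting *)

Lemma sum_card_level (T : finType) (n : nat) (A : 'I_n -> pred T) :
  (\sum_p #|A p| = \sum_t #|[pred p | A p t]|)%N.
Proof.
transitivity (\sum_p \sum_t (A p t : nat))%N.
  apply: eq_bigr => p _; rewrite -sum1_card big_mkcond.
  by apply: eq_bigr => t _; rewrite unfold_in; case: (A p t).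
rewrite exchange_big; apply: eq_bigr => t _ /=.
rewrite -sum1_card [RHS]big_mkcond.
by apply: eq_bigr => p _; rewrite inE; case: (A p t).
Qed.

(** Disjointness bounds the total size of the [A q] by that of [T], which the levels of [r] already
    exhaust, so no termwise inequality can be strict. *)
Lemma card_disjoint_levels (T : finType) (n : nat) (r : T -> nat)
    (A : nat -> pred T) :
  (forall t, (r t < n)%N) ->
  (forall p, #|[pred t | r t == p]| <= #|A p|)%N ->
  (forall p p' t, A p t -> A p' t -> p = p') ->
  forall p, (p < n)%N -> #|A p| = #|[pred t | r t == p]|.
Proof.
move=> rn rA disj p pn; apply/eqP; rewrite eqn_leq rA andbT.
have : (\sum_(q < n) #|A q| <= \sum_(q < n) #|[pred t | r t == q]|)%N.
  rewrite (@sum_card_level _ _ (fun q : 'I_n => A q)).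
  rewrite (@sum_card_level _ _ (fun q : 'I_n => [pred t | r t == q])).
  apply: leq_sum => t _; apply: (@leq_trans 1).
    apply/card_le1P => q + q'; rewrite !inE => Aq; apply/idP/idP => [h|/eqP -> //].
    by apply/eqP/val_inj; apply: disj h Aq.
  by apply/card_gt0P; exists (Ordinal (rn t)); rewrite inE /= eqxx.
rewrite (bigD1 (Ordinal pn)) //= [leqRHS](bigD1 (Ordinal pn)) //= => le_sum.
rewrite -(leq_add2r (\sum_(q < n | q != Ordinal pn) #|[pred t | r t == q]|)).
by apply: leq_trans le_sum; rewrite leq_add2l leq_sum.
Qed.

Lemma card_band (T : finType) (R : realDomainType) (g : T -> R) (r : T -> nat)
    (p : nat) (lo hi : R) :
  (#|[pred t | (g t < lo)%R]| <= #|[pred t | p < r t]|)%N ->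
  (#|[pred t | (hi < g t)%R]| <= #|[pred t | r t < p]|)%N ->
  (#|[pred t | r t == p]| <= #|[pred t | (lo <= g t <= hi)%R]|)%N.
Proof.
move=> le_lo le_hi.
have cr : (#|[pred t | r t == p]| + (#|[pred t | p < r t]| + #|[pred t | r t < p]|) = #|T|)%N.
  rewrite -[#|T|](cardC [pred t | r t == p]); congr addn.
  rewrite -(cardID [pred t | (p < r t)%N] (predC _)).
  congr addn; apply: eq_card => t; rewrite !inE; lia.
have cg : (#|T| <= #|[pred t | (lo <= g t <= hi)%R]| +
    (#|[pred t | (g t < lo)%R]| + #|[pred t | (hi < g t)%R]|))%N.
  rewrite -[#|T|](cardC [pred t | (lo <= g t <= hi)%R]) leq_add2l.
  rewrite -(cardID [pred t | (g t < lo)%R] (predC _)) leq_add //.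
    by apply: subset_leq_card; apply/fintype.subsetP => t; rewrite !inE => /andP[].
  apply: subset_leq_card; apply/fintype.subsetP => t; rewrite !inE negb_and -!ltNge.
  by move=> /andP[/negPf -> /=].
by move: cr cg le_lo le_hi; lia.
Qed.

(** * Ranks of the nodes inside their clusters *)

Section Labelling.
Variables (R : realType) (M : nat) (s : 'I_M -> nat).
Let S := (\sum_(k < M) s k)%N.
Variables (x : 'I_S -> R) (C : 'I_M -> {fset R}).
Hypothesis x_inj : injective x.
Hypothesis XC : [fset x i | i in 'I_S]%fset = (\bigcup_(k in 'I_M) C k)%fset.
Hypothesis C_disj : forall k l, k != l -> [disjoint C k & C l]%fset.
Hypothesis C_card : forall k, #|` C k| = s k.

(** The rank is the position in the enumeration of the cluster as a finite set; it need not follow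
    the order of the angles. *)
Lemma exists_labelling : exists (kap : 'I_S -> 'I_M) (r : 'I_S -> nat),
  [/\ forall i k, (x i \in C k) = (kap i == k),
      forall i, (r i < s (kap i))%N,
      forall i j, kap i = kap j -> r i = r j -> i = j
    & forall k m, (m < s k)%N -> exists2 j, kap j = k & r j = m].
Proof.
have [kap kapP] : exists kap : 'I_S -> 'I_M, forall i, x i \in C (kap i).
  apply: (fin_all_exists (P := fun i k => x i \in C k)) => i.
  have : x i \in [fset x i | i in 'I_S]%fset by apply/imfsetP; exists i.
  by rewrite XC => /bigfcupP[k _ xk]; exists k.
have kapE i k : (x i \in C k) = (kap i == k).
  apply/idP/eqP => [xk|<-//]; apply/eqP; apply: contraT => /C_disj/fdisjointP.
  by move=> /(_ _ (kapP i)); rewrite xk.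
exists kap, (fun i => index (x i) (C (kap i))); split => //.
- by move=> i; rewrite -C_card index_mem.
- move=> i j ij; rewrite ij => rij; apply: x_inj.
  rewrite -(nth_index 0 (kapP j)) -rij nth_index //.
  by rewrite -ij; exact: kapP.
- move=> k m; rewrite -C_card => mk; set y := nth 0 (C k) m.
  have yC : y \in C k by exact: mem_nth.
  have : y \in [fset x i | i in 'I_S]%fset.
    by rewrite XC; apply/bigfcupP; exists k; rewrite // mem_index_enum.
  case/imfsetP => j /= _ yj; have kj : kap j = k.
    by apply/eqP; rewrite -kapE -yj.
  by exists j; rewrite // kj -yj index_uniq // fset_uniq.
Qed.

End Labelling.

Lemma sqrtr_lt_pos (R : rcfType) (a b : R) : 0 < b ->
  (Num.sqrt a < b) = (a < b ^+ 2).
Proof. by move=> b0; rewrite -{1}(gtr0_norm b0) -sqrtr_sqr ltr_sqrt ?exprn_gt0. Qed.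

Lemma sqrtr_gt_nneg (R : rcfType) (a b : R) : 0 <= b ->
  (b < Num.sqrt a) = (b ^+ 2 < a).
Proof.
move=> b0; have [a0|a0] := ltP 0 a.
  by rewrite -{1}(ger0_norm b0) -sqrtr_sqr ltr_sqrt.
rewrite ler0_sqrtr // [in LHS]ltNge b0; apply/esym/negbTE.
by rewrite -leNgt (le_trans a0) // sqr_ge0.
Qed.

(** [kap] sends the nodes of rank [p] bijectively to the clusters with more than [p] nodes; ranks
    start at 0, hence [p.+1]. *)
Lemma card_level_ell (T : finType) (M : nat) (s : 'I_M -> nat)
    (kap : T -> 'I_M) (r : T -> nat) (p : nat) :
  (forall i, (r i < s (kap i))%N) ->
  (forall i j, kap i = kap j -> r i = r j -> i = j) ->
  (forall k m, (m < s k)%N -> exists2 j, kap j = k & r j = m) ->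
  #|[pred i | r i == p]| = ell s p.+1.
Proof.
move=> rs r_inj r_onto; rewrite /ell -(card_in_image (f := kap)).
  apply: eq_card => k; apply/fintype.imageP/idP => [[i + ->]|].
    by rewrite !inE => /eqP <-.
  by rewrite inE => /r_onto[i <- rp]; exists i; rewrite // inE rp.
by move=> i j; rewrite !inE => /eqP ri /eqP rj ij; apply: r_inj; rewrite ?ri.
Qed.

(** * Choice of constants and separation of the bands *)

Theorem corollary2p1 (R : realType) (M : nat) (s : 'I_M -> nat)
    (tau : 'I_M -> R)
    (hM : (1 <= M)%N)
    (hs : forall k, (0 < s k)%N)
    (htau : forall k, 0 < tau k) :
  exists C12 C13 c C : R,
    [/\ 0 < C12, 0 < C13, 0 < c, 0 < C &
      forall (h : 'I_M -> R) (h0 theta : R)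
        (x : 'I_(\sum_(k < M) s k) -> R),
      (forall k, h k = h0) ->
      injective x ->
      clustered_configuration h tau s theta
        [fset x i | i in 'I_(\sum_(k < M) s k)]%fset ->
      forall N : nat,
      ((\sum_(k < M) s k).-1 <= N)%N ->
      C12 <= N%:R * theta ->
      N%:R * h0 <= C13 ->
      forall j : nat, (1 <= j <= \max_(k < M) s k)%N ->
      count (fun sigma : R =>
          c * (Num.sqrt N%:R * (N%:R * h0) ^+ j.-1) <= sigma
            <= C * (Num.sqrt N%:R * (N%:R * h0) ^+ j.-1))
        (singular_values (vandermonde N x)) = ell s j].
Proof.
have sleS k : (s k <= \sum_(l < M) s l)%N by rewrite (bigD1 k) //= leq_addr.
have S0 : (0 < \sum_(k < M) s k)%N.
  exact: leq_trans (hs (Ordinal hM)) (sleS _).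
set S := (\sum_(k < M) s k)%N in sleS S0 *.
have SR0 : 0 < S%:R :> R by rewrite ltr0n.
(* [u^-1] is a positive lower bound for every [tau k]; the 4 in [t] pays for replacing arcs by
   chords. *)
pose u : R := \sum_k (tau k)^-1.
have u_ge k : (tau k)^-1 <= u.
  by rewrite /u (bigD1 k) //= lerDl sumr_ge0 // => l _; rewrite invr_ge0 ltW.
have u0 : 0 < u by apply: lt_le_trans (u_ge (Ordinal hM)); rewrite invr_gt0.
pose t := u^-1 / 4.
have t0 : 0 < t by rewrite divr_gt0 // invr_gt0.
have tk k : t <= tau k / 4.
  by rewrite ler_pM2r // invf_ple ?posrE.
pose c := lower_constant S t; pose Cst : R := 3 * S%:R.
have c0 : 0 < c.
  rewrite invr_gt0; set B := 4 + _; have B0 : 0 < B.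
    by rewrite ltr_wpDr // ltW // divr_gt0 // mulr_gt0.
  have BS0 : 0 < B ^+ S by rewrite exprn_gt0.
  apply: mulr_gt0; first by rewrite mulr_gt0 // exprn_gt0.
  by rewrite mulr_gt0 // exprn_gt0 // ltr_wpDr // mulr_ge0 ?ler0n // ltW.
have Cst0 : 0 < Cst by rewrite mulr_gt0.
(* The first constant is [4 * (2 * S)], as chords between clusters are at least [theta / 4]. The
   bound 1/2 serves both estimates, and [c / (2 * Cst)] separates the bands. *)
exists (8 * S%:R), (Num.min (1 / 2) (c / (2 * Cst))), c, Cst; split => //.
- by rewrite mulr_gt0.
- by rewrite lt_min divr_gt0 //= divr_gt0 // mulr_gt0.
move=> h h0 theta x hh x_inj [theta0 [C [XC Cdisj Ccl Csep]]] N SN Ntheta Nh.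
move=> j /andP[j1 jmax].
have N0 : (0 < N)%N.
  rewrite lt0n; apply: contraTneq Ntheta => ->.
  by rewrite mul0r -ltNge mulr_gt0.
have NR0 : 0 < N%:R :> R by rewrite ltr0n.
have SN1 : (S <= N.+1)%N by rewrite -(prednK S0) ltnS.
have h00 : 0 < h0 by case: (Ccl (Ordinal hM)); rewrite hh.
have Ccard k : #|` C k| = s k by case: (Ccl k).
have [kap [r [kapE rs r_inj r_onto]]] := exists_labelling x_inj XC Cdisj Ccard.
pose z i := expi (x i).
have z1 i : normc (z i) = 1 by exact: normc_expi.
have VE : vandermonde N x = power_matrix z N.
  by apply/matrixP => a b; rewrite !mxE expi_natmul.
have xC i : x i \in C (kap i) by rewrite kapE.
have x_pi i : - pi < x i <= pi by case: (Ccl (kap i)) => _ _ _ + _; apply.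
have chord a b := chord_wrap_dist (x_pi a) (x_pi b).
have dist a b : kap a = kap b -> a != b ->
    tau (kap a) * h0 <= wrap_dist (x a) (x b) <= h0.
  move=> ab nab; case: (Ccl (kap a)) => _ _ _ _; rewrite hh; apply => //.
    by rewrite ab.
  by rewrite (inj_eq x_inj).
have z_le a b : kap a = kap b -> normc (z a - z b) <= h0.
  move=> ab; have [->|nab] := eqVneq a b.
    by rewrite subrr ComplexField.Normc.normc0 ltW.
  have /andP[_ le1] := chord a b; have /andP[_ le2] := dist a b ab nab.
  exact: le_trans le1 le2.
have z_ge a b : kap a = kap b -> a != b -> t * h0 <= normc (z a - z b).
  move=> ab nab; have /andP[le1 _] := chord a b.
  have /andP[le2 _] := dist a b ab nab; apply: le_trans le1.
  apply: (@le_trans _ _ (tau (kap a) / 4 * h0)); first by rewrite ler_pM2r.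
  by rewrite mulrAC ler_pM2r.
have z_sep a b : kap a != kap b -> theta / 4 <= normc (z a - z b).
  move=> ab; have /andP[le1 _] := chord a b; apply: le_trans le1.
  rewrite ler_pM2r //; apply: (Csep (kap a)) => //.
  rewrite in_fsetD kapE eq_sym ab /=; apply/imfsetP; by exists b.
have Ntheta4 : 2 * S%:R <= N%:R * (theta / 4) by lra.
move: Nh; rewrite le_min => /andP[Nh2 Nhc].
(* One node of each cluster serves as its centre, hence has modulus 1 and lies within [h0] of the
   others. *)
have [cj kap_cj] : exists cj : 'I_M -> 'I_S, forall k, kap (cj k) = k.
  apply: (fin_all_exists (P := fun k i => kap i = k)) => k.
  by have [i ik _] := r_onto k 0%N (hs k); exists i.
set X := N%:R * h0.
have X0 : 0 < X by rewrite mulr_gt0.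
have sN0 : 0 < Num.sqrt (N%:R : R) by rewrite sqrtr_gt0.
have rS i : (r i < S)%N by apply: leq_trans (rs i) (sleS _).
pose g i := gram_eigenvalue (power_matrix z N) i.
pose e p := Num.sqrt N%:R * X ^+ p.
have e0 p : 0 < e p by rewrite mulr_gt0 // exprn_gt0.
pose band p := [pred i | c * e p <= Num.sqrt (g i) <= Cst * e p].
have card_hi p : (#|[pred i | (Cst * e p < Num.sqrt (g i))%R]| <=
    #|[pred i | r i < p]|)%N.
  rewrite (eq_card (B := [pred i | ((Cst * e p) ^+ 2 < g i)%R])); last first.
    by move=> i; rewrite !inE sqrtr_gt_nneg // mulr_ge0 ?ltW.
  apply: (card_gram_eigenvalue_gt (f := moment_functional z kap r (z \o cj) p)).
  move=> v fv; apply: (power_matrix_normsq_le (kap := kap)) fv => //.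
  - move=> i m mi; apply: r_onto; exact: leq_ltn_trans mi (rs i).
  - by move=> k; exact: z1.
  - by move=> i; apply: z_le; rewrite kap_cj.
have card_lo p : (#|[pred i | (Num.sqrt (g i) < c * e p)%R]| <=
    #|[pred i | (p < r i)%N]|)%N.
  rewrite (eq_card (B := [pred i | (g i < (c * e p) ^+ 2)%R])); last first.
    by move=> i; rewrite !inE sqrtr_lt_pos // mulr_gt0.
  have [f hf] := power_matrix_normsq_ge z1 rS r_inj t0 h00 N0 SN1 Nh2 Ntheta4
    z_le z_ge z_sep.
  by apply: (card_gram_eigenvalue_lt (f := f)) => v fv; exact: hf.
have disj p q i : band p i -> band q i -> p = q.
  (* A larger exponent gains at least one factor [X], and [Cst * X <= c / 2], so the top of band [b]
     lies below the bottom of band [a]. *)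
  have lt_disj a b : (a < b)%N -> c * e a <= Num.sqrt (g i) ->
      Num.sqrt (g i) <= Cst * e b -> False.
    move=> ab lo hi; have := le_trans lo hi; apply/negP; rewrite -ltNge.
    have X1 : X <= 1 by move: Nh2; rewrite -/X; lra.
    apply: (@le_lt_trans _ _ (Cst * (X * e a))).
      rewrite ler_pM2l // /e mulrCA ler_pM2l // -exprS.
      by rewrite ler_wiXn2l // ltW.
    rewrite mulrA ltr_pM2r //; move: Nhc; rewrite -/X ler_pdivlMr ?mulr_gt0 //.
    by move: c0; lra.
  move=> /andP[plo phi] /andP[qlo qhi].
  case: (ltngtP p q) => // pq; exfalso.
    exact: lt_disj pq plo qhi.
  exact: lt_disj pq qlo phi.
have jS : (j.-1 < S)%N.
  rewrite prednK //; apply: leq_trans jmax _; apply/bigmax_leqP => k _; exact: sleS.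
rewrite VE count_singular_values //.
rewrite -[X in ell s X](prednK j1).
rewrite -(card_level_ell j.-1 rs r_inj r_onto).
apply: (card_disjoint_levels (A := band)) jS => // p.
exact: card_band.
Qed.
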